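(* Consider the single-input control-affine system $\dot{x} = f(x) + g(x)u$ and a Lipschitz continuous exponential CBF $h$ with relative degree $r<n$ and rates $\gamma_1,\dots,\gamma_r>0$, written in the cascading constraint coordinates as $\dot{\varphi} = A_\gamma \varphi + B\mu$, $\dot{\eta} = q_{\mathrm{cbf}}(\eta,\varphi)$. Let $x_0\in S_\varphi$. Suppose the fixed-virtual-control-input global exponential minimum phase condition holds: there exists $\mu_e\ge0$ such that $\dot\eta = q_{\mathrm{cbf}}(\eta,\Gamma\mu_e)$ has a globally exponentially stable equilibrium $\eta_e$. Then under $\mu(t)\equiv\mu_e$, the trajectory satisfies $(\varphi(t),\eta(t))\to(\Gamma\mu_e,\eta_e)$ as $t\to\infty$. Thus the system under the barrier constraint can stay bounded.
   Context: The system $\dot x = f(x)+g(x)u$ has $f,g:\mathbb{R}^n\to\mathbb{R}^n$ Lipschitz and $u\in\mathbb{R}$. For a scalar function $h$, $L_f$, $L_g$ denote Lie derivatives. $h$ has relative degree $r$ at $x$ if $L_gL_f^k h\equiv 0$ near $x$ for $k=0,\dots,r-2$ and $L_gL_f^{r-1}h(x)\neq 0$. An exponential CBF with relative degree $r$ is $h:\mathbb{R}^n\to\mathbb{R}$ with relative degree $r$ on $\mathcal{C}=\{h\ge 0\}$, $\partial h/\partial x\neq0$ on $\{h=0\}$, and $\sup_{u}[L_f^r h(x)+L_gL_f^{r-1}h(x)u+k^\top\xi(x)]\ge 0$ on $\mathcal{C}$, where $\xi=[h,L_fh,\dots,L_f^{r-1}h]^\top$ and $s^r+k_rs^{r-1}+\dots+k_1=(s+\gamma_1)\cdots(s+\gamma_r)$,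 $\gamma_i>0$. Virtual control input: $\mu(x,u)=L_f^rh+L_gL_f^{r-1}h\,u+k^\top\xi$; barrier constraint: $\mu\ge0$. Cascading constraint vector: $\varphi_1=h$, $\varphi_{i+1}=\dot\varphi_i+\gamma_i\varphi_i$; $S_\varphi=\{x:\varphi(x)\in\mathbb{R}^r_{\ge0}\}$. $A_\gamma$ is the $r\times r$ upper bidiagonal matrix with diagonal $-\gamma_1,\dots,-\gamma_r$ and superdiagonal entries $1$; $B=[0,\dots,0,1]^\top$; $\Gamma=-A_\gamma^{-1}B=[(\gamma_1\cdots\gamma_r)^{-1},(\gamma_2\cdots\gamma_r)^{-1},\dots,\gamma_r^{-1}]^\top$. The internal state $\eta\in\mathbb{R}^{n-r}$ is chosen so that $x\mapsto(\varphi,\eta)$ is a diffeomorphism and $L_g\eta_j\equiv 0$; then $\dot\varphi=A_\gamma\varphi+B\mu$, $\dot\eta=q_{\mathrm{cbf}}(\eta,\varphi)$ with $q_{\mathrm{cbf}}$ Lipschitz in $\eta$ and $\varphi$. Any signal $\mu(t)$ can be realized by a choice of $u$. *)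

(* Defs.v *)
From HB Require Import structures.
From mathcomp Require Import all_boot all_order all_algebra.
From mathcomp Require Import all_classical all_reals all_analysis.
Set Implicit Arguments. Unset Strict Implicit. Unset Printing Implicit Defensive.
Import Order.TTheory GRing.Theory Num.Theory.
Import numFieldNormedType.Exports.
Local Open Scope classical_set_scope.
Local Open Scope ring_scope.

Definition A_gamma {R : realType} (r : nat) (gamma : 'I_r -> R) : 'M[R]_r :=
  \matrix_(i, j) (if i == j then - gamma i
                  else if (j : nat) == (i : nat).+1 then 1 else 0).

Definition B_vec {R : realType} (r : nat) : 'cV[R]_r :=
  \col_i (if (i : nat) == r.-1 then 1 else 0).

Definition Gamma_vec {R : realType} (r : nat) (gamma : 'I_r -> R) : 'cV[R]_r :=
  - (invmx (A_gamma gamma) *m B_vec r).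

Definition solves_on_nonneg {R : realType} (k : nat)
  (F : R -> 'cV[R]_k -> 'cV[R]_k) (y : R -> 'cV[R]_k) : Prop :=
  (y t @[t --> 0^'+] --> y 0) /\
  (forall t : R, 0 < t -> is_derive t 1 y (F t (y t))).

Definition GES_equilibrium {R : realType} (k : nat)
  (Q : 'cV[R]_k -> 'cV[R]_k) (eta_e : 'cV[R]_k) : Prop :=
  Q eta_e = 0 /\
  exists c lam : R, 0 < c /\ 0 < lam /\
    forall xi : R -> 'cV[R]_k,
      solves_on_nonneg (fun _ y => Q y) xi ->
      forall t : R, 0 <= t ->
        `|xi t - eta_e| <= c * `|xi 0 - eta_e| * expR (- (lam * t)).

Definition lipschitz2 {R : realType} (m r : nat)
  (q : 'cV[R]_m -> 'cV[R]_r -> 'cV[R]_m) : Prop :=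
  exists L : R, 0 <= L /\ forall e1 e2 p1 p2,
    `|q e1 p1 - q e2 p2| <= L * (`|e1 - e2| + `|p1 - p2|).

Definition nonneg_vec {R : realType} (r : nat) (v : 'cV[R]_r) : Prop :=
  forall i, 0 <= v i ord0.

(* Main.v *)
(** The coordinates of [phi] form a cascade [y' = - gamma_i y + w], where [w] is
    the next coordinate, so they converge one after the other starting from the
    last one.

    For [eta] no converse Lyapunov theorem is needed. Fix [T] such that
    [c * exp (- lam T) <= 1 / 2]. On a window [[s, s + T]], compare [eta] with
    the solution of the frozen system [x' = q x (Gamma mu_e)] issued from
    [eta s], which exists by Picard-Lindelof. By Gronwall the two differ by at
    most a constant times the supremum of [|phi - Gamma mu_e|] over [[s, +oo[], which
    tends to 0. Hence [v = |eta - eta_e|] satisfies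
    [v (s + T) <= v s / 2 + o(1)], so [v] tends to 0. *)
Require Import Defs.
From HB Require Import structures.
From mathcomp Require Import all_boot all_order all_algebra.
From mathcomp Require Import all_classical all_reals all_analysis.
From mathcomp Require Import ring lra.
Set Implicit Arguments.
Unset Strict Implicit.
Import Order.TTheory GRing.Theory Num.Theory.
Import numFieldNormedType.Exports.
Local Open Scope classical_set_scope.
Local Open Scope ring_scope.

(** * Vector-valued limits and derivatives by coordinates *)

Lemma is_derive_mxP (R : realType) (m n : nat) (M : R -> 'M[R]_(m, n))
    (t v : R) (dM : 'M[R]_(m, n)) :
  is_derive t v M dM <->
  forall i j, is_derive t v (fun x => M x i j) (dM i j).
Proof.
split=> [[Mt <-] i j|Mt].
  split; first exact: (derivable_mxP M t v).1.
  by rewrite derive_mx// mxE.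
have dM' : derivable M t v.
  by apply/derivable_mxP => i j; have [] := Mt i j.
split=> //; rewrite derive_mx//; apply/matrixP => i j; rewrite mxE.
exact: derive_val.
Qed.

(** The norm is the maximum of the absolute values of the entries. An empty maximum is 0, so
    [0 <= e] is what makes the equivalence hold for [m = 0]. *)
Lemma cV_norm_leP (R : realType) (m : nat) (x : 'cV[R]_m) (e : R) : 0 <= e ->
  `|x| <= e <-> forall i, `|x i ord0| <= e.
Proof.
move=> e0; rewrite [X in X <= e]/Num.Def.normr/= mx_normrE; split=> [xe i|xe].
  by apply: le_trans xe; exact: (le_bigmax _ _ (i, ord0)).
by apply: bigmax_le => // -[i j] _ /=; rewrite (ord1 j).
Qed.

Lemma cV_norm_coord (R : realType) (m : nat) (x : 'cV[R]_m) i :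
  `|x i ord0| <= `|x|.
Proof. by apply/(cV_norm_leP _ _).1. Qed.

Lemma cvg_cV (R : realType) (m : nat) (T : Type) (F : set_system T)
    (FF : Filter F) (x : T -> 'cV[R]_m) (l : 'cV[R]_m) :
  x @ F --> l <-> forall i, x t i ord0 @[t --> F] --> l i ord0.
Proof.
split=> [xl i|xl].
  exact: (cvg_comp _ _ xl (@coord_continuous R m 1 i ord0 l)).
apply/cvgrPdist_le => /= e e0; near=> t.
apply/cV_norm_leP => [|i]; first exact: ltW.
rewrite !mxE; move: i; near: t; apply: filter_forall => i.
by move/cvgrPdist_le : (xl i); exact.
Unshelve. all: by end_near. Qed.

(** * Mean value inequalities *)

(** Mean value theorem on [[s, t]]. The regularity matches [solves_on_nonneg]: only right continuity
    at [a], which serves when [s = a], and two-sided derivatives after [a], which also give left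
    continuity at [t]. *)
Lemma ge0_derive_le (R : realType) (f df : R -> R) (a b : R) :
  f t @[t --> a^'+] --> f a ->
  (forall t : R, a < t -> is_derive t 1 f (df t)) ->
  (forall t : R, a < t -> t < b -> 0 <= df t) ->
  forall s t, a <= s -> s <= t -> t <= b -> f s <= f t.
Proof.
move=> f0 dfE df0 s t sa; rewrite le_eqVlt => /predU1P[->//|st] tb.
have ct u : a < u -> {for u, continuous f}.
  move=> ua; apply/differentiable_continuous/derivable1_diffP.
  by have [] := dfE u ua.
have cst : {within `[s, t], continuous f}.
  apply/continuous_within_itvP => //; split.
  - move=> u /[!in_itv]/= /andP[su _]; apply: ct; exact: le_lt_trans su.
  - move: sa; rewrite le_eqVlt => /predU1P[<-//|sa].
    by apply: cvg_at_right_filter; exact: ct.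
  - by apply: cvg_at_left_filter; apply: ct; exact: le_lt_trans st.
have [u|u /[!in_itv]/= /andP[su ut] E] := MVT st _ cst (df := df).
  by rewrite in_itv/= => /andP[su _]; apply: dfE; exact: le_lt_trans su.
rewrite -subr_ge0 E mulr_ge0 ?subr_ge0 ?(ltW st)// df0//.
  exact: le_lt_trans su.
exact: lt_le_trans ut tb.
Qed.

(** Both [g - f] and [g + f] have nonnegative derivatives on the open interval. *)
Lemma derive_norm_le (R : realType) (f df g dg : R -> R) (a b : R) :
  f t @[t --> a^'+] --> f a -> (forall t : R, a < t -> is_derive t 1 f (df t)) ->
  g t @[t --> a^'+] --> g a -> (forall t : R, a < t -> is_derive t 1 g (dg t)) ->
  (forall t : R, a < t -> t < b -> `|df t| <= dg t) ->
  forall s t, a <= s -> s <= t -> t <= b -> `|f t - f s| <= g t - g s.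
Proof.
move=> f0 dfE g0 dgE fg s t sa st tb.
have hB : (g - f) s <= (g - f) t.
  apply: (@ge0_derive_le R (g - f) (dg - df) a b) => //.
  - exact: cvgB.
  - move=> u ua; have ? := dfE u ua; have ? := dgE u ua; exact: is_deriveB.
  - by move=> u ua ub; have := fg u ua ub; rewrite ler_norml !fctE/=; lra.
have hD : (g + f) s <= (g + f) t.
  apply: (@ge0_derive_le R (g + f) (dg + df) a b) => //.
  - exact: cvgD.
  - move=> u ua; have ? := dfE u ua; have ? := dgE u ua; exact: is_deriveD.
  - by move=> u ua ub; have := fg u ua ub; rewrite ler_norml !fctE/=; lra.
by move: hB hD; rewrite !fctE ler_norml; lra.
Qed.

(** * Scalar linear equations with a vanishing input *)

Lemma is_derive_continuous (R : realType) (V : normedModType R) (f : R -> V)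
    (t : R) (df : V) :
  is_derive t 1 f df -> {for t, continuous f}.
Proof. by case=> ? _; apply/differentiable_continuous/derivable1_diffP. Qed.

Lemma is_derive_expRM (R : realType) (a t : R) :
  is_derive t 1 (fun s => expR (a * s)) (a * expR (a * t)).
Proof.
have ? : is_derive t 1 (fun s => a * s) a.
  have := is_deriveZ a (is_derive_id t (1 : R)); rewrite /= scaler1; exact.
rewrite mulrC; exact: (is_derive1_comp (f := expR) (g := fun s => a * s)).
Qed.

Lemma cvg_expRNM (R : realType) (a C : R) : 0 < a ->
  C * expR (- (a * t)) @[t --> +oo] --> 0.
Proof.
move=> a0; rewrite -[X in _ --> X](mulr0 C); apply: cvgM; first exact: cvg_cst.
apply: (cvg_comp (fun t => a * t) (fun t => expR (- t)) _ (@cvgr_expR R)).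
by apply: gt0_cvgMry => //; exact: cvg_id.
Qed.
(** Integrating factor: the derivative of [(e - y s) * expR (a * s)] is
    [(a * e - w s) * expR (a * s)], which is nonnegative. *)
Lemma decay_le (R : realType) (y w : R -> R) (a e T : R) :
  (forall t : R, T <= t -> is_derive t 1 y (- a * y t + w t)) ->
  (forall t : R, T <= t -> w t <= a * e) ->
  forall t, T <= t -> y t <= e + (y T - e) * expR (a * T) * expR (- (a * t)).
Proof.
move=> dy we t Tt.
have H : (e - y T) * expR (a * T) <= (e - y t) * expR (a * t).
  apply: (@ge0_derive_le R (fun s => (e - y s) * expR (a * s))
    (fun s => (a * e - w s) * expR (a * s)) T t) => //.
- apply: cvg_at_right_filter.
  have ? := dy T (lexx T); have ? := is_derive_expRM a T.
  apply: cvgM; last exact: is_derive_continuous.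
  by apply: cvgB; [exact: cvg_cst|exact: is_derive_continuous].
- move=> s Ts; have ? := dy s (ltW Ts); have ? := is_derive_expRM a s.
  have ? : is_derive s 1 (cst e - y) (0 - (- a * y s + w s)) by exact: is_deriveB.
  have -> : (a * e - w s) * expR (a * s) =
     (e - y s) *: (a * expR (a * s)) + expR (a * s) *: (0 - (- a * y s + w s)).
    by rewrite /GRing.scale /=; ring.
  exact: (is_deriveM (f := cst e - y)).
- by move=> s Ts _; rewrite mulr_ge0 ?expR_ge0// subr_ge0 we// ltW.
rewrite -(ler_pM2r (expR_gt0 (- (a * t)))) -[X in _ <= X]mulrA -expRD subrr
  expR0 mulr1 in H.
lra.
Qed.

(** Once [|w|] stays below [a * (e / 2)], [decay_le] applied to [y] and to [- y] bounds [|y|] by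
    [e / 2] plus a transient that dies out exponentially. *)
Lemma cvg_decay (R : realType) (y w : R -> R) (a : R) : 0 < a ->
  (forall t : R, 0 < t -> is_derive t 1 y (- a * y t + w t)) ->
  w t @[t --> +oo] --> 0 -> y t @[t --> +oo] --> 0.
Proof.
move=> a0 dy w0; apply/cvgrPdist_le => /= e e0.
have e20 : 0 < e / 2 by rewrite divr_gt0.
have ae0 : 0 < a * (e / 2) by rewrite mulr_gt0.
move/cvgrPdist_le : w0 => /(_ _ ae0)/= wae.
have [T [T0 wT]] : exists T, 0 < T /\ forall t, T <= t -> `|w t| <= a * (e / 2).
  (* The 1 keeps [T] positive, where the equation holds; [T0 + 1] is there because a neighbourhood
     of infinity only controls [t > T0]. *)
  case: wae => T0 [_ hT]; exists (Num.max 1 (T0 + 1)); split.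
    by rewrite lt_max ltr01.
  move=> t; rewrite ge_max => /andP[_ Tt]; have := hT t.
  by rewrite sub0r normrN; apply; apply: lt_le_trans Tt; rewrite ltrDl.
have up t : T <= t -> y t <= e / 2 + (y T - e / 2) * expR (a * T) * expR (- (a * t)).
  apply: (@decay_le _ y w) => s Ts; first by apply: dy; exact: lt_le_trans Ts.
  by have := wT _ Ts; rewrite ler_norml => /andP[].
have lo t : T <= t -> - y t <= e / 2 + (- y T - e / 2) * expR (a * T) * expR (- (a * t)).
  apply: (@decay_le _ (- y) (- w)) => s Ts; last first.
    by have := wT _ Ts; rewrite ler_norml !fctE; lra.
  have ? := dy s (lt_le_trans T0 Ts).
  have -> : - a * (- y) s + (- w) s = - (- a * y s + w s) by rewrite !fctE mulrN opprD.
  exact: is_deriveN.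
have := @cvg_expRNM _ a ((y T - e / 2) * expR (a * T)) a0.
move=> /cvgrPdist_le/(_ _ e20) A.
have := @cvg_expRNM _ a ((- y T - e / 2) * expR (a * T)) a0.
move=> /cvgrPdist_le/(_ _ e20) B.
near=> t; have Tt : T <= t by near: t; apply: nbhs_pinfty_ge; exact: num_real.
have At : `|0 - ((y T - e / 2) * expR (a * T)) * expR (- (a * t))| <= e / 2 by near: t.
have Bt : `|0 - ((- y T - e / 2) * expR (a * T)) * expR (- (a * t))| <= e / 2 by near: t.
move: At Bt (up _ Tt) (lo _ Tt); rewrite !sub0r !normrN !ler_norml; lra.
Unshelve. all: by end_near. Qed.

(** * Convergence of the cascade *)

(** [A_gamma] is upper triangular; it is transposed because [det_trig] is about lower triangular
    matrices. *)
Lemma A_gamma_unitmx (R : realType) (r : nat) (gamma : 'I_r -> R) :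
  (forall i, gamma i != 0) -> A_gamma gamma \in unitmx.
Proof.
move=> g0; rewrite unitmxE -det_tr det_trig.
  rewrite unitfE; apply/prodf_neq0 => i _.
  by rewrite !mxE eqxx oppr_eq0.
apply/is_trig_mxP => i j ij; rewrite !mxE.
by rewrite -val_eqE /= gtn_eqF// ltn_eqF// ltnW.
Qed.

(** The sum has at most one nonzero term, at [j = i + 1], and none for the last coordinate. Keeping
    it as a sum spares a case distinction on whether [i] has a successor. *)
Lemma A_gamma_coord (R : realType) (r : nat) (gamma : 'I_r -> R) (p : 'cV[R]_r) i :
  (A_gamma gamma *m p) i ord0 = - gamma i * p i ord0 +
    \sum_(j < r | j != i) (if j == i.+1 :> nat then 1 else 0) * p j ord0.
Proof.
rewrite mxE (bigD1 i)//= mxE eqxx; congr (_ + _).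
by apply: eq_bigr => j ji; rewrite mxE eq_sym (negbTE ji).
Qed.

Lemma phi_cvg (R : realType) (r : nat) (gamma : 'I_r -> R) (mu : R)
    (phi : R -> 'cV[R]_r) :
  (forall i, 0 < gamma i) ->
  solves_on_nonneg (fun _ p => A_gamma gamma *m p + mu *: B_vec r) phi ->
  phi t @[t --> +oo] --> mu *: Gamma_vec gamma.
Proof.
move=> g0 [_ dphi]; set z := mu *: Gamma_vec gamma.
(* [z] is the equilibrium of the equation of [phi]. From here on it is used only through [Az], which
   turns the affine equation into [psi' = A_gamma psi] for [psi = phi - z]. *)
have Az : A_gamma gamma *m z = - (mu *: B_vec r).
  rewrite /z -scalemxAr mulmxN mulKVmx ?scalerN//.
  by apply: A_gamma_unitmx => i; rewrite gt_eqF.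
clearbody z.
have dpsi i (t : R) : 0 < t -> is_derive t 1 (fun s => phi s i ord0 - z i ord0)
    (- gamma i * (phi t i ord0 - z i ord0) +
    \sum_(j < r | j != i) (if j == i.+1 :> nat then 1 else 0) *
      (phi t j ord0 - z j ord0)).
  move=> t0; have /is_derive_mxP/(_ i ord0) := dphi t t0.
  have -> : A_gamma gamma *m phi t + mu *: B_vec r = A_gamma gamma *m (phi t - z).
    by rewrite mulmxBr Az opprK.
  rewrite A_gamma_coord !mxE => H.
  have ? := is_derive_cst (z i ord0) t (1 : R).
  apply: (is_derive_eq (is_deriveB _ _)); rewrite subr0.
  by congr (_ + _); apply: eq_bigr => j _; rewrite !mxE.
(* Downward induction along the cascade: [k] bounds the number of coordinates from [i] to the last
   one, so that [k = 0] is void. *)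
suff psi0 k (i : 'I_r) : (r - i <= k)%N -> phi t i ord0 - z i ord0 @[t --> +oo] --> 0.
  apply/cvg_cV => i; rewrite -[X in _ --> X]add0r.
  under eq_fun do rewrite -[phi _ _ _](subrK (z i ord0)).
  by apply: cvgD; [exact: (psi0 (r - i)%N)|exact: cvg_cst].
elim: k i => [i|k IH i].
  by rewrite leqn0 subn_eq0 leqNgt ltn_ord.
move=> rik; apply: (cvg_decay (g0 i) (fun t => @dpsi i t)).
(* The limit 0 is written as a sum of zeros, to pass to the limit term by term; the only term with
   coefficient 1 is covered by the induction hypothesis. *)
have E : \sum_(j < r | j != i) (0 : R) = 0 by rewrite big1.
rewrite -[X in _ --> X]E.
apply: cvg_big => [|j ji]; first exact: add_continuous.
 case: ifPn => [/eqP ij|_].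
  rewrite -[X in _ --> X](mulr0 1); apply: cvgM; first exact: cvg_cst.
  by apply: IH; rewrite ij -ltnS; apply: leq_trans rik; rewrite ltn_sub2l// -ij.
by under eq_fun do rewrite mul0r; exact: cvg_cst.
Qed.

(** * Gronwall inequality in the sup norm *)

(** The sum of squares [W] satisfies [W' <= a * (W + e ^+ 2)], so [(W + e ^+ 2) * expR (- a * s)]
    decreases from [e ^+ 2]. This bounds [W], hence [|D| ^+ 2], by [e ^+ 2 * expR (a * t)]. *)
Lemma gronwall_cV (R : realType) (m : nat) (D dD : R -> 'cV[R]_m) (L e : R) :
  0 <= L -> 0 <= e ->
  D t @[t --> 0^'+] --> D 0 -> D 0 = 0 ->
  (forall t : R, 0 < t -> is_derive t 1 D (dD t)) ->
  (forall t : R, 0 < t -> `|dD t| <= L * (`|D t| + e)) ->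
  forall t : R, 0 <= t -> `|D t| <= e * expR (3 * m%:R * L * t).
Proof.
move=> L0 e0 cD D0 dDE dDle t t0.
(* The sup norm is not differentiable, the sum of squares is. *)
pose W s := \sum_(i < m) D s i ord0 ^+ 2.
pose dW s := \sum_(i < m) 2 * D s i ord0 * dD s i ord0.
set a := 3 * m%:R * L.
have a0 : 0 <= a by rewrite !mulr_ge0.
have normW s : `|D s| ^+ 2 <= W s.
  have W0 : 0 <= W s by apply: sumr_ge0 => i _; exact: sqr_ge0.
  rewrite -[leRHS]sqr_sqrtr// ler_sqr ?nnegrE ?sqrtr_ge0//.
  apply/cV_norm_leP => [|i]; first exact: sqrtr_ge0.
  rewrite -sqrtr_sqr ler_sqrt// /W (bigD1 i)//= lerDl sumr_ge0// => j _.
  exact: sqr_ge0.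
have dWE (s : R) : 0 < s -> is_derive s 1 W (dW s).
  move=> s0; have /is_derive_mxP dDs := dDE s s0.
  have -> : W = \sum_(i < m) (fun s => D s i ord0) ^+ 2.
    by apply/funext => u; rewrite fct_sumE.
  exact: is_derive_sum.
have cW : W s @[s --> 0^'+] --> W 0.
  apply: cvg_big => [|i _]; first exact: add_continuous.
  by move/cvg_cV : cD => /(_ i) cD; apply: cvgM.
have dWle s : 0 < s -> dW s <= a * (W s + e ^+ 2).
  move=> s0; have Ds := dDle s s0.
  (* Each of the [m] terms of [dW] is at most [2 * L * |D| * (|D| + e)], and
     [2 * |D| * e <= |D| ^+ 2 + e ^+ 2] yields the factor 3. *)
  apply: (@le_trans _ _ (\sum_(i < m) 3 * L * (W s + e ^+ 2))); last first.
    rewrite sumr_const card_ord -mulr_natl /a le_eqVlt.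
    by apply/orP; left; apply/eqP; ring.
  apply: ler_sum => i _.
  apply: (@le_trans _ _ (2 * (`|D s| * (L * (`|D s| + e))))).
    rewrite -mulrA ler_pM2l//; apply: le_trans (ler_norm _) _.
    rewrite normrM ler_pM//; first exact: cV_norm_coord.
    by apply: le_trans Ds; exact: cV_norm_coord.
  apply: (@le_trans _ _ (3 * L * (`|D s| ^+ 2 + e ^+ 2))); last first.
    by rewrite ler_wpM2l ?mulr_ge0// lerD2r.
  rewrite -subr_ge0.
  have -> : 3 * L * (`|D s| ^+ 2 + e ^+ 2) - 2 * (`|D s| * (L * (`|D s| + e))) =
     L * ((`|D s| - e) ^+ 2 + 2 * e ^+ 2) by ring.
  by rewrite mulr_ge0// addr_ge0 ?sqr_ge0// mulr_ge0// sqr_ge0.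
have W0 : W 0 = 0 by rewrite /W big1// => i _; rewrite D0 mxE expr0n.
have H : - (W 0 + e ^+ 2) * expR (- a * 0) <= - (W t + e ^+ 2) * expR (- a * t).
  apply: (@ge0_derive_le R (fun s => - (W s + e ^+ 2) * expR (- a * s))
    (fun s => (a * (W s + e ^+ 2) - dW s) * expR (- a * s)) 0 t) => //.
  - have ? := is_derive_expRM (- a) 0.
    apply: cvgM; last by apply: cvg_at_right_filter; exact: is_derive_continuous.
    by apply: cvgN; apply: cvgD; [|exact: cvg_cst].
  - move=> s s0; have ? := dWE s s0; have ? := is_derive_expRM (- a) s.
    have ? : is_derive s 1 (- (W + cst (e ^+ 2))) (- (dW s + 0)).
      exact: is_deriveN.
    apply: (is_derive_eq (is_deriveM (f := - (W + cst (e ^+ 2))) _ _)).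
    by rewrite /GRing.scale/= !fctE; ring.
  - by move=> s s0 _; rewrite mulr_ge0 ?expR_ge0// subr_ge0 dWle.
rewrite W0 mulr0 expR0 mulr1 add0r -(ler_pM2r (expR_gt0 (a * t))) in H.
have E : expR (- a * t) * expR (a * t) = 1 by rewrite -expRD mulNr addNr expR0.
rewrite -[leRHS]mulrA E mulr1 in H.
have E1 : 1 <= expR (a * t) by rewrite -expR0 ler_expR mulr_ge0.
(* Taking the square root would halve the exponent; the cruder [expR (a * t) <= expR (a * t) ^+ 2]
   is enough. *)
rewrite -ler_sqr ?nnegrE ?mulr_ge0 ?expR_ge0//.
apply: le_trans (normW t) _; rewrite exprMn.
apply: (@le_trans _ _ (e ^+ 2 * expR (a * t))).
  by have := sqr_ge0 e; lra.
by rewrite ler_wpM2l ?sqr_ge0// expr2 ler_peMl ?expR_ge0.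
Qed.

(** * Global Picard-Lindelof theorem for Lipschitz fields *)

(* Integrating from [-1] instead of [0] makes the derivative at [0] two-sided;
   [Num.max 0 s] extends [f] continuously to the negative reals. *)
Definition primitive (R : realType) (f : R -> R) (t : R) : R :=
  (\int[lebesgue_measure]_(s in `[(-1)%R, t]) f (Num.max 0 s)
   - \int[lebesgue_measure]_(s in `[(-1)%R, 0%R]) f (Num.max 0 s))%R.

Lemma primitive0 (R : realType) (f : R -> R) : primitive f 0 = 0.
Proof. exact: subrr. Qed.

Lemma is_derive_primitive (R : realType) (f : R -> R) :
  (forall t : R, 0 <= t -> {for t, continuous f}) ->
  forall t : R, 0 <= t -> is_derive t 1 (primitive f) (f t).
Proof.
move=> cf t t0.
have cg : continuous (fun s : R => f (Num.max 0 s)).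
  move=> s; have cs : {for Num.max 0 s, continuous f}.
    by apply: cf; rewrite le_max lexx.
  apply: (cvg_comp (fun x => Num.max 0 x) f _ cs).
  by apply: (@continuous_max _ _ (cst 0) id); [exact: cvg_cst|exact: cvg_id].
(* Integrability up to [t + 1] makes [t] an interior point, as the fundamental theorem of calculus
   asks. *)
have ig : (@lebesgue_measure R).-integrable `[(-1)%R, (t + 1)%R]
    (EFin \o (fun s : R => f (Num.max 0 s))).
  apply: continuous_compact_integrable; first exact: segment_compact.
  exact: continuous_subspaceT.
have tt1 : t < t + 1 by rewrite ltrDl.
have t1 : -1 < t by apply: lt_le_trans t0; rewrite ltrN10.
have [dF FE] := continuous_FTC1_closed tt1 ig t1 (cg t).
rewrite -[X in is_derive _ _ _ X]subr0; apply: is_deriveB.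
by apply: DeriveDef => //; rewrite -derive1E FE max_r.
Qed.

Lemma derive_norm_le_cV (R : realType) (m : nat) (f df : R -> 'cV[R]_m)
    (g dg : R -> R) (a b : R) :
  f t @[t --> a^'+] --> f a -> (forall t : R, a < t -> is_derive t 1 f (df t)) ->
  g t @[t --> a^'+] --> g a -> (forall t : R, a < t -> is_derive t 1 g (dg t)) ->
  (forall t : R, a < t -> t < b -> `|df t| <= dg t) -> a <= b ->
  `|f b - f a| <= g b - g a.
Proof.
move=> fa dfE ga dgE fg ab.
have gab : g a <= g b.
  apply: (@ge0_derive_le R g dg a b) => // t at_ tb.
  exact: le_trans (normr_ge0 _) (fg t at_ tb).
apply/cV_norm_leP => [|i]; first by rewrite subr_ge0.
rewrite !mxE; apply: (@derive_norm_le R (fun t => f t i ord0)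
  (fun t => df t i ord0) g dg a b) => //.
- by move/cvg_cV : fa.
- by move=> t at_; have /is_derive_mxP := dfE t at_.
- by move=> t at_ tb; apply: le_trans (fg t at_ tb); exact: cV_norm_coord.
Qed.

(** The difference quotient is within [K * |h|] of [v]. A quadratic bound is a closed condition, so
    it survives pointwise limits, unlike differentiability itself. *)
Lemma quadratic_is_derive (R : realType) (V : normedModType R) (x : R -> V)
    (t K : R) (v : V) : 0 <= K ->
  (\forall s \near t, `|x s - x t - (s - t) *: v| <= K * (s - t) ^+ 2) ->
  is_derive t 1 x v.
Proof.
move=> K0 xK; suff dx : h^-1 *: (x (h *: 1 + t) - x t) @[h --> 0^'] --> v.
  by apply: DeriveDef; [apply/cvg_ex; exists v|exact/cvg_lim].
apply/cvgrPdist_le => /= e e0.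
have xK' : \forall h \near (0 : R), `|x (h + t) - x t - h *: v| <= K * h ^+ 2.
  have ht : h + t @[h --> (0 : R)] --> t.
    by rewrite -[X in _ --> X]add0r; apply: cvgD; [exact: cvg_id|exact: cvg_cst].
  have H : \forall h \near (0 : R),
      `|x (h + t) - x t - (h + t - t) *: v| <= K * (h + t - t) ^+ 2 by exact: (ht _ xK).
  by apply: filterS H => h; rewrite addrK.
near=> h.
have h0 : h != 0 by near: h; exact: nbhs_dnbhs_neq.
have hh : `|x (h + t) - x t - h *: v| <= K * h ^+ 2.
  by near: h; exact: (nbhs_dnbhs xK').
rewrite distrC (_ : h *: 1 = h); last exact: mulr1.
rewrite -[v in X in _ - X]scale1r -(mulVf h0) -scalerA -scalerBr normrZ normfV.
rewrite ler_pdivrMl ?normr_gt0//; apply: le_trans hh _.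
rewrite -[h ^+ 2]ger0_norm ?sqr_ge0// normrX expr2 mulrA mulrC ler_wpM2l//.
(* Dividing by [K + 1] rather than [K] covers [K = 0]. *)
have hK : `|h| <= e / (K + 1).
  by near: h; apply: dnbhs0_le; rewrite divr_gt0// ltr_wpDl.
apply: le_trans (ler_wpM2l K0 hK) _.
by rewrite mulrCA ler_piMr ?(ltW e0)// ler_pdivrMr ?ltr_wpDl// mul1r lerDl.
Unshelve. all: by end_near. Qed.

Fixpoint picard (R : realType) (m : nat) (Q : 'cV[R]_m -> 'cV[R]_m)
    (y : 'cV[R]_m) (k : nat) : R -> 'cV[R]_m :=
  if k is k'.+1 then
    fun t => y + \col_i primitive (fun s => Q (picard Q y k' s) i ord0) t
  else cst y.

Section picard_theory.
Variables (R : realType) (m : nat) (Q : 'cV[R]_m -> 'cV[R]_m) (L : R).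
Hypothesis L0 : 0 <= L.
Hypothesis lipQ : forall x y, `|Q x - Q y| <= L * `|x - y|.
Variable y : 'cV[R]_m.

Let p := picard Q y.
Let c := `|Q y|.
(* Each Picard step halves distances weighted by [expR (- (a * t))]. *)
Let a := 2 * L + 1.

Let a1 : 1 <= a. Proof. by rewrite lerDr mulr_ge0. Qed.
Let a0 : 0 < a. Proof. by apply: lt_le_trans a1. Qed.
Let c0 : 0 <= c. Proof. exact: normr_ge0. Qed.

Let continuousQ : continuous Q.
Proof.
move=> x; apply/(@cvgrPdist_le _ _ _ _ (nbhs_filter x)) => /= e e0.
have xe : \forall z \near x, `|x - z| <= e / (L + 1).
  apply: (@cvgr_dist_le _ _ _ (nbhs x) (nbhs_filter x) id x cvg_id).
  by rewrite divr_gt0// ltr_wpDl.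
apply: filterS xe => z xz; apply: le_trans (lipQ _ _) _.
apply: le_trans (ler_wpM2l L0 xz) _.
by rewrite mulrCA ler_piMr ?(ltW e0)// ler_pdivrMr ?ltr_wpDl// mul1r lerDl.
Qed.

(** Induction is needed because the fundamental theorem requires [Q] composed with the previous
    iterate to be continuous, which comes from the derivative of that iterate. *)
Let is_derive_picard k (t : R) : 0 <= t -> is_derive t 1 (p k.+1) (Q (p k t)).
Proof.
elim: k t => [|k IH] t t0; (apply/is_derive_mxP => i j; rewrite (ord1 j)).
  have cQ (s : R) : 0 <= s -> {for s, continuous (fun s => Q (p 0 s) i ord0)}.
    by move=> _; exact: cst_continuous.
  have ? := is_derive_primitive cQ t0.
  have -> : (fun x => p 1 x i ord0) = cst (y i ord0) +
      primitive (fun s => Q (p 0 s) i ord0).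
    by apply/funext => x; rewrite /p /= !mxE.
  by rewrite -[X in is_derive _ _ _ X]add0r; exact: is_deriveD.
have cQ (s : R) : 0 <= s -> {for s, continuous (fun s => Q (p k.+1 s) i ord0)}.
  move=> s0; have cp := is_derive_continuous (IH s s0).
  apply: (@cvg_comp _ _ _ (fun s => Q (p k.+1 s)) (fun M : 'cV[R]_m => M i ord0)
    _ _ _ _ (@coord_continuous R m 1 i ord0 _)).
  exact: (cvg_comp _ _ cp (@continuousQ _)).
have ? := is_derive_primitive cQ t0.
have -> : (fun x => p k.+2 x i ord0) = cst (y i ord0) +
    primitive (fun s => Q (p k.+1 s) i ord0).
  by apply/funext => x; rewrite /p /= !mxE.
by rewrite -[X in is_derive _ _ _ X]add0r; exact: is_deriveD.
Qed.

Let continuous_picard k (t : R) : 0 <= t -> {for t, continuous (p k)}.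
Proof.
case: k => [|k] t0; first exact: cvg_cst.
exact: is_derive_continuous (is_derive_picard k t0).
Qed.

Let picard0 k : p k 0 = y.
Proof.
by case: k => //= k; apply/matrixP => i j; rewrite !mxE primitive0 addr0 (ord1 j).
Qed.

Let is_derive_cexp (C t : R) :
  is_derive t 1 (fun s => C * expR (a * s)) (C * (a * expR (a * t))).
Proof. by have ? := is_derive_expRM a t; exact: is_deriveZ. Qed.

(** Consecutive iterates agree at 0, so derivatives are compared: [L * (2 * C) <= a * C] in the
    induction step, and [1 <= a] for [k = 0]. The exponential weight gives convergence on the whole
    half-line, not just on a short interval. *)
Let picard_step k (t : R) : 0 <= t ->
  `|p k.+1 t - p k t| <= c / 2 ^+ k * expR (a * t).
Proof.
elim: k t => [|k IH] t t0.
  rewrite expr0 divr1 -[p 0 t](picard0 1).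
  apply: (@le_trans _ _ (c * expR (a * t) - c * expR (a * 0))); last first.
    by rewrite gerBl mulr_ge0 ?expR_ge0.
  apply: (@derive_norm_le_cV R m (p 1) (fun s => Q (p 0 s))
    (fun s => c * expR (a * s)) (fun s => c * (a * expR (a * s)))) => //.
  - by apply: cvg_at_right_filter; exact: continuous_picard.
  - by move=> s s0; apply: is_derive_picard; exact: ltW.
  - exact: cvg_at_right_filter (is_derive_continuous (is_derive_cexp c 0)).
  - move=> s s0 _; rewrite ler_peMr// mulr_ege1// -expR0 ler_expR.
    by rewrite mulr_ge0 ?ltW.
have -> : p k.+2 t - p k.+1 t = (p k.+2 - p k.+1) t - (p k.+2 - p k.+1) 0.
  by rewrite !fctE !picard0 subrr subr0.
set C := c / 2 ^+ k.+1.
have C0 : 0 <= C by rewrite divr_ge0.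
apply: (@le_trans _ _ (C * expR (a * t) - C * expR (a * 0))); last first.
  by rewrite gerBl mulr_ge0 ?expR_ge0.
apply: (@derive_norm_le_cV R m (p k.+2 - p k.+1)
  (fun s => Q (p k.+1 s) - Q (p k s))
  (fun s => C * expR (a * s)) (fun s => C * (a * expR (a * s)))) => //.
- by apply: cvgB; apply: cvg_at_right_filter; exact: continuous_picard.
- by move=> s s0; apply: is_deriveB; apply: is_derive_picard; exact: ltW.
- exact: cvg_at_right_filter (is_derive_continuous (is_derive_cexp C 0)).
- move=> s s0 _; apply: le_trans (lipQ _ _) _.
  apply: le_trans (ler_wpM2l L0 (IH s (ltW s0))) _.
  have -> : c / 2 ^+ k = 2 * C.
    by rewrite /C exprS; field; rewrite expf_neq0.
  rewrite -subr_ge0.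
  have -> : C * (a * expR (a * s)) - L * (2 * C * expR (a * s)) = C * expR (a * s).
    by rewrite /a; ring.
  by rewrite mulr_ge0 ?expR_ge0.
Qed.

(** Telescoping: the terms [1 / 2 ^+ i] for [k <= i < k + j] add up to
    [2 / 2 ^+ k - 2 / 2 ^+ (k + j)]. *)
Let picard_dist k j (t : R) : 0 <= t ->
  `|p (k + j) t - p k t| <= c * expR (a * t) * (2 / 2 ^+ k - 2 / 2 ^+ (k + j)).
Proof.
move=> t0; elim: j => [|j IH]; first by rewrite addn0 !subrr normr0 mulr0.
have := picard_step (k + j) t0; rewrite addnS => S.
rewrite -(subrKA (p (k + j)%N t)); apply: le_trans (ler_normD _ _) _.
apply: le_trans (lerD S IH) _; rewrite le_eqVlt; apply/orP; left; apply/eqP.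
by rewrite exprS; field; rewrite !expf_neq0.
Qed.

Let picard_near0 k (t : R) : 0 <= t -> `|p k t - y| <= 2 * c * expR (a * t).
Proof.
move=> t0; have := picard_dist 0 k t0; rewrite add0n expr0 divr1 => H.
apply: le_trans H _; rewrite [leRHS](_ : _ = c * expR (a * t) * 2); last by ring.
rewrite ler_wpM2l// ?mulr_ge0 ?expR_ge0//.
by rewrite gerBl divr_ge0// exprn_ge0.
Qed.

Let picard_cvg (t : R) : 0 <= t -> cvg (p k t @[k --> \oo]).
Proof.
move=> t0; apply: cauchy_cvg; apply: cauchy_exP => e e0.
have C0 : 0 <= c * expR (a * t) by rewrite mulr_ge0 ?expR_ge0.
have : geometric (c * expR (a * t) * 2) 2^-1 n @[n --> \oo] --> (0 : R).
  by apply: cvg_geometric; rewrite ger0_norm ?invr_ge0// invf_lt1// ltr1n.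
move/cvgrPdist_lt => /(_ e e0) [k _ hk].
exists (p k t); exists k => // n /= kn; rewrite -ball_normE /= distrC.
have := hk k (leqnn k); rewrite /= sub0r normrN; apply: le_lt_trans.
rewrite -(subnKC kn); apply: le_trans (picard_dist k (n - k) t0) _.
apply: le_trans (ler_norm _); rewrite -[leRHS]mulrA ler_wpM2l//.
by rewrite exprVn gerBl divr_ge0// exprn_ge0.
Qed.

(** A bound on the speed of all iterates over [[0, b]], from [|Q x| <= c + L * |x - y|] and
    [picard_near0]. *)
Let M b := c + L * (2 * c * expR (a * b)).

Let normQ_picard k b (t : R) : 0 <= t -> t <= b -> `|Q (p k t)| <= M b.
Proof.
move=> t0 tb; rewrite -[Q (p k t)](subrK (Q y)); apply: le_trans (ler_normD _ _) _.
rewrite addrC lerD2l; apply: le_trans (lipQ _ _) _.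
rewrite ler_wpM2l//; apply: le_trans (picard_near0 k t0) _.
by rewrite ler_wpM2l ?mulr_ge0// ler_expR ler_pM2l.
Qed.

Let M0 b : 0 <= M b.
Proof. by rewrite addr_ge0// !mulr_ge0 ?expR_ge0. Qed.

Let picard_lip k b (s t : R) : 0 <= s -> s <= t -> t <= b ->
  `|p k t - p k s| <= M b * (t - s).
Proof.
move=> s0 st tb; case: k => [|k].
  by rewrite subrr normr0 mulr_ge0// subr_ge0.
rewrite mulrBr; apply: (@derive_norm_le_cV R m (p k.+1) (fun s => Q (p k s))
    (fun s => M b * s) (fun s => M b)) => //.
- by apply: cvg_at_right_filter; exact: continuous_picard.
- by move=> u su; apply: is_derive_picard; exact: ltW (le_lt_trans s0 su).
- by apply: cvgM; [exact: cvg_cst|apply: cvg_at_right_filter; exact: cvg_id].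
- move=> u su; have := is_deriveZ (M b) (is_derive_id u (1 : R)).
  by rewrite [_ *: 1]mulr1.
- move=> u su ut; apply: normQ_picard; first exact: ltW (le_lt_trans s0 su).
  exact: le_trans (ltW ut) tb.
Qed.

(* This bound is uniform in [k], so that differentiability of the limit only
   requires pointwise convergence. *)
Let picard_quad k b (r s t : R) : 0 <= s -> s <= t -> t <= b -> s <= r <= t ->
  `|p k.+1 t - p k.+1 s - (t - s) *: Q (p k r)| <= L * M b * (t - s) ^+ 2.
Proof.
move=> s0 st tb /andP[sr rt]; set v := Q (p k r).
(* The derivative of [f] is [Q (p k u) - Q (p k r)], at most [L * M b * (t - s)] since [u] and [r]
   both lie in [[s, t]]. *)
pose f u := p k.+1 u - u *: v.
have -> : p k.+1 t - p k.+1 s - (t - s) *: v = f t - f s.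
  by rewrite /f scalerBl !opprB addrACA [RHS]addrACA; congr (_ + _); exact: addrC.
set K := L * M b * (t - s).
have -> : L * M b * (t - s) ^+ 2 = K * t - K * s by rewrite /K; ring.
have idz (u : R) : is_derive u 1 ( *:%R^~ v : R -> 'cV[R]_m) v.
  apply/is_derive_mxP => i j.
  have -> : (fun x : R => (x *: v) i j) = v i j \*: id.
    by apply/funext => x; rewrite mxE mulrC.
  by have := is_deriveZ (v i j) (is_derive_id u (1 : R)); rewrite [_ *: 1]mulr1.
apply: (@derive_norm_le_cV R m f (fun u => Q (p k u) - v)
    (fun s => K * s) (fun s => K)) => //.
- by apply: cvgB; apply: cvg_at_right_filter;
    [exact: continuous_picard|exact: is_derive_continuous].
- move=> u su; have ? := is_derive_picard k (ltW (le_lt_trans s0 su)).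
  exact: is_deriveB.
- by apply: cvgM; [exact: cvg_cst|apply: cvg_at_right_filter; exact: cvg_id].
- move=> u su; have := is_deriveZ K (is_derive_id u (1 : R)).
  by rewrite [_ *: 1]mulr1.
- move=> u su ut; apply: le_trans (lipQ _ _) _.
  rewrite /K -mulrA ler_wpM2l//.
  have [ur|/ltW ru] := leP u r.
    rewrite distrC; have u0 := ltW (le_lt_trans s0 su).
    apply: le_trans (picard_lip k u0 ur (le_trans rt tb)) _.
    rewrite ler_wpM2l//; lra.
  apply: le_trans (picard_lip k (le_trans s0 sr) ru (le_trans (ltW ut) tb)) _.
  rewrite ler_wpM2l//; lra.
Qed.

(** The pointwise limit [xi] of the iterates inherits [picard_quad], whence its derivative by
    [quadratic_is_derive], and [picard_lip], whence right continuity at 0. *)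
Lemma picard_lindelof : exists xi : R -> 'cV[R]_m,
  xi 0 = y /\ solves_on_nonneg (fun _ x => Q x) xi.
Proof.
pose xi (t : R) := lim (p k t @[k --> \oo]).
have xiE (t : R) : 0 <= t -> p k t @[k --> \oo] --> xi t by exact: picard_cvg.
have norm_lim (u : nat -> 'cV[R]_m) l C :
    u @ \oo --> l -> (forall k, `|u k| <= C) -> `|l| <= C.
  move=> ul uC; apply: (ler_cvg_to (cvg_norm ul) (cvg_cst C)).
  by apply: nearW => k; exact: uC.
have xi_quad b (r s t : R) : 0 <= s -> s <= t -> t <= b -> s <= r <= t ->
    `|xi t - xi s - (t - s) *: Q (xi r)| <= L * M b * (t - s) ^+ 2.
  move=> s0 st tb srt; have /andP[sr rt] := srt.
  apply: (norm_lim (fun k => p k.+1 t - p k.+1 s - (t - s) *: Q (p k r))).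
    apply: cvgB.
      apply: cvgB; rewrite (cvg_shiftS (fun k => p k _)); apply: xiE => //.
      exact: le_trans st.
    have cr : p k r @[k --> \oo] --> xi r by apply: xiE; exact: le_trans sr.
    by apply: cvgZr; exact: (cvg_comp _ _ cr (@continuousQ _)).
  by move=> k; exact: picard_quad.
have xi_lip (t : R) : 0 <= t -> t <= 1 -> `|xi t - xi 0| <= M 1 * t.
  move=> t0 t1; apply: (norm_lim (fun k => p k t - p k 0)).
    by apply: cvgB; exact: xiE.
  by move=> k; rewrite -[t in leRHS]subr0; exact: picard_lip.
exists xi; split.
  apply/cvg_lim => //; rewrite (_ : (fun k => p k 0) = cst y); first exact: cvg_cst.
  by apply/funext => k; exact: picard0.
split.
  apply/cvgrPdist_le => /= e e0; near=> t.
  have t0 : 0 <= t by near: t; exact: nbhs_right_ge.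
  rewrite distrC; apply: le_trans (xi_lip t t0 _) _.
    by near: t; apply: nbhs_right_le.
  have te : t <= e / (M 1 + 1).
    by near: t; apply: nbhs_right_le; rewrite divr_gt0// ltr_wpDl.
  apply: le_trans (ler_wpM2l (M0 1) te) _.
  by rewrite mulrCA ler_piMr ?(ltW e0)// ler_pdivrMr ?ltr_wpDl// mul1r lerDl.
move=> t t0; apply: (@quadratic_is_derive R _ xi t (L * M (t + 1))).
  by rewrite mulr_ge0.
near=> s.
have s0 : 0 <= s by apply/ltW; near: s; exact: lt_nbhsr.
have st1 : s <= t + 1 by apply/ltW; near: s; apply: lt_nbhsl; rewrite ltrDl.
(* The base point [t] is the left end of the interval in one case and the right end in the other;
   hence the free point [r] in [xi_quad]. *)
have [ts|/ltW st] := leP t s.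
  by apply: (@xi_quad _ t) => //; [exact: ltW|rewrite lexx].
have tt1 : t <= t + 1 by rewrite lerDl.
have := @xi_quad (t + 1) t s t s0 st tt1; rewrite st lexx => /(_ isT) H.
rewrite -[s - t]opprB sqrrN; apply: le_trans H.
by rewrite scaleNr opprK -[leLHS]normrN !opprD opprK [- xi s + _]addrC.
Unshelve. all: by end_near. Qed.

End picard_theory.

(** * Asymptotics of the internal state *)

(** At the times [S + n * T] the value is halved up to an error, and the errors add up to at most
    twice one of them. The bound with factor [c] controls [v] between these times. *)
Lemma cvg0_eventual_contraction (R : realType) (v : R -> R) (T c : R) :
  0 < T -> 0 <= c -> (forall t, 0 <= v t) ->
  (forall e, 0 < e -> exists S, forall s, S <= s ->
    (forall d, 0 <= d -> d <= T -> v (s + d) <= c * v s + e) /\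
    v (s + T) <= v s / 2 + e) ->
  v t @[t --> +oo] --> 0.
Proof.
move=> T0 c0 v0 H; apply/cvgrPdist_le => /= e e0.
have e'0 : 0 < e / 2 / (2 * c + 1) by rewrite !divr_gt0// ltr_wpDl// mulr_ge0.
(* Chosen so that [c * (2 * e') + e' = e / 2]. *)
set e' := e / 2 / (2 * c + 1) in e'0.
have [S HS] := H _ e'0.
have step n : v (S + n%:R * T) <= v S / 2 ^+ n + 2 * e'.
  elim: n => [|n IH]; first by rewrite mul0r addr0 expr0 divr1 lerDl mulr_ge0// ltW.
  have : S <= S + n%:R * T by rewrite lerDl mulr_ge0// ltW.
  have -> : S + n.+1%:R * T = S + n%:R * T + T by rewrite -natr1; ring.
  move=> /HS[_] /le_trans; apply.
  have -> : v S / 2 ^+ n.+1 = v S / 2 ^+ n / 2.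
    by rewrite exprS; field; rewrite expf_neq0.
  by lra.
have : geometric (c * v S) 2^-1 n @[n --> \oo] --> (0 : R).
  by apply: cvg_geometric; rewrite ger0_norm ?invr_ge0// invf_lt1// ltr1n.
move/cvgrPdist_le => /(_ (e / 2) (divr_gt0 e0 _))[//|N _ hN].
near=> t; rewrite sub0r normrN ger0_norm//.
have tN : S + N%:R * T <= t by near: t; apply: nbhs_pinfty_ge; exact: num_real.
(* [j] is the index of the window containing [t]: [S + j * T <= t < S + (j + 1) * T]. *)
pose j := Num.truncn ((t - S) / T).
have tS0 : 0 <= (t - S) / T.
  rewrite divr_ge0 ?(ltW T0)// subr_ge0; apply: le_trans tN.
  by rewrite lerDl mulr_ge0// ltW.
have /andP[jt tj] := Num.Theory.truncn_itv tS0.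
rewrite -/j ler_pdivlMr// in jt; rewrite -/j ltr_pdivrMr// in tj.
have Nj : (N <= j)%N.
  by rewrite Num.Theory.truncn_ge_nat// ler_pdivlMr//; lra.
have Sj : S <= S + j%:R * T by rewrite lerDl mulr_ge0// ltW.
have [+ _] := HS _ Sj; move=> /(_ (t - (S + j%:R * T))).
rewrite [_ + (t - _)]addrC subrK => vt.
have {}vt : v t <= c * v (S + j%:R * T) + e'.
  by apply: vt; [lra|move: tj; rewrite -natr1; lra].
have hj : c * v S / 2 ^+ j <= e / 2.
  have := hN j Nj; rewrite /= sub0r normrN exprVn; apply: le_trans; exact: ler_norm.
have E : c * (2 * e') + e' = e / 2.
  by rewrite /e'; field; rewrite gt_eqF// ltr_wpDl// mulr_ge0.
have := ler_wpM2l c0 (step j); rewrite mulrDr mulrA; lra.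
Unshelve. all: by end_near. Qed.

Lemma is_derive_shiftl (R : realType) (m : nat) (f : R -> 'cV[R]_m) (s t : R) df :
  is_derive (s + t) 1 f df -> is_derive t 1 (fun u => f (s + u)) df.
Proof.
move=> /is_derive_mxP fs; apply/is_derive_mxP => i j; have ? := fs i j.
have ? : is_derive t 1 (fun u => s + u) 1.
  have := is_deriveD (is_derive_cst s t (1 : R)) (is_derive_id t 1).
  by rewrite add0r.
rewrite -[df i j]mulr1.
exact: (is_derive1_comp (f := fun x => f x i j) (g := fun u => s + u)).
Qed.

(** Gronwall for the difference of [eta (s + u)] and [xi u], which starts at 0 and whose derivative
    is at most [L * (|eta - xi| + |phi - z|)]. *)
Lemma frozen_comparison (R : realType) (m r : nat)
    (q : 'cV[R]_m -> 'cV[R]_r -> 'cV[R]_m) (L : R) (z : 'cV[R]_r)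
    (eta xi : R -> 'cV[R]_m) (phi : R -> 'cV[R]_r) (s e : R) :
  0 <= L -> (forall e1 e2 p1 p2,
    `|q e1 p1 - q e2 p2| <= L * (`|e1 - e2| + `|p1 - p2|)) ->
  0 < s -> (forall t : R, 0 < t -> is_derive t 1 eta (q (eta t) (phi t))) ->
  xi 0 = eta s -> solves_on_nonneg (fun _ x => q x z) xi ->
  (forall t, s <= t -> `|phi t - z| <= e) ->
  forall d, 0 <= d -> `|eta (s + d) - xi d| <= e * expR (3 * m%:R * L * d).
Proof.
move=> L0 Lq s0 deta xi0 [cxi dxi] phie d d0.
have e0 : 0 <= e by apply: le_trans (phie s (lexx _)).
have deta' (u : R) : 0 <= u ->
    is_derive u 1 (fun u => eta (s + u)) (q (eta (s + u)) (phi (s + u))).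
  by move=> u0; apply: is_derive_shiftl; apply: deta; rewrite ltr_wpDr.
apply: (@gronwall_cV R m ((fun u => eta (s + u)) - xi)
  (fun u => q (eta (s + u)) (phi (s + u)) - q (xi u) z)) => //.
- apply: cvgB => //; apply: cvg_at_right_filter.
  exact: is_derive_continuous (deta' 0 (lexx _)).
- by rewrite !fctE addr0 xi0 subrr.
- by move=> u u0; have ? := deta' u (ltW u0); have ? := dxi u u0; exact: is_deriveB.
- move=> u u0; apply: le_trans (Lq _ _ _ _) _.
  by rewrite ler_wpM2l// lerD2l phie// lerDl ltW.
Qed.
Unset Implicit Arguments.

Theorem theorem5 (R : realType) (n r : nat) (hr0 : (0 < r)%N) (hrn : (r < n)%N)
  (gamma : 'I_r -> R) (hgamma : forall i, 0 < gamma i)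
  (q : 'cV[R]_(n - r) -> 'cV[R]_r -> 'cV[R]_(n - r))
  (hq : lipschitz2 q)
  (mu_e : R) (hmu : 0 <= mu_e) (eta_e : 'cV[R]_(n - r))
  (hGES : GES_equilibrium (fun eta => q eta (mu_e *: Gamma_vec gamma)) eta_e)
  (phi : R -> 'cV[R]_r) (eta : R -> 'cV[R]_(n - r))
  (h0 : nonneg_vec (phi 0))
  (hphi : solves_on_nonneg (fun _ p => A_gamma gamma *m p + mu_e *: B_vec r) phi)
  (heta : solves_on_nonneg (fun t e => q e (phi t)) eta) :
  (phi t @[t --> +oo] --> mu_e *: Gamma_vec gamma) /\
  (eta t @[t --> +oo] --> eta_e).
Proof.
have phi_lim := phi_cvg hgamma hphi; split=> //.
case: hq => L [L0 Lq]; case: hGES => _ [c [lam [c0 [lam0 ges]]]].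
case: heta => _ deta; set z := mu_e *: Gamma_vec gamma in phi_lim ges.
have [T T0 cT] : exists2 T : R, 0 < T & c * expR (- (lam * T)) <= 1 / 2.
  have /cvgrPdist_le/(_ (1 / 2)) := @cvg_expRNM R lam c lam0.
  rewrite divr_gt0// => /(_ isT) H; near (pinfty_nbhs R) => T.
  exists T; first by near: T; apply: nbhs_pinfty_gt; exact: num_real.
  apply: le_trans (ler_norm _) _; rewrite -normrN -sub0r; near: T; exact: H.
suff : `|eta t - eta_e| @[t --> +oo] --> 0.
  by move/norm_cvg0P/cvg_sub0; apply; exact: cvg_cst.
apply: (@cvg0_eventual_contraction R _ T c) => //; first exact: ltW.
move=> e e0; set K := expR (3 * (n - r)%:R * L * T).
have eK : 0 < e / K by rewrite divr_gt0// expR_gt0.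
have /cvgrPdist_le/(_ _ eK) [S [_ hS]] := phi_lim.
(* The 1 ensures [0 < s], so that [eta] is differentiable at the start of the window. *)
exists (Num.max 1 (S + 1)) => s; rewrite ge_max => /andP[s1 Ss].
have s0 : 0 < s by exact: lt_le_trans s1.
have phis t : s <= t -> `|phi t - z| <= e / K.
  move=> st; rewrite distrC; apply: hS; apply: lt_le_trans st.
  by apply: lt_le_trans Ss; rewrite ltrDl.
have lipz x y : `|q x z - q y z| <= L * `|x - y|.
  by apply: le_trans (Lq _ _ _ _) _; rewrite subrr normr0 addr0.
have [xi [xi0 dxi]] := picard_lindelof L0 lipz (eta s).
have close d : 0 <= d -> d <= T ->
    `|eta (s + d) - eta_e| <= c * `|eta s - eta_e| * expR (- (lam * d)) + e.
  move=> d0 dT; rewrite -(subrKA (xi d)) addrC; apply: le_trans (ler_normD _ _) _.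
  apply: lerD; first by rewrite -xi0; exact: ges.
  apply: le_trans (frozen_comparison L0 Lq s0 deta xi0 dxi phis d0) _.
  rewrite mulrAC ler_pdivrMr ?expR_gt0// ler_wpM2l ?(ltW e0)//.
  by rewrite ler_expR ler_wpM2l// !mulr_ge0.
(* Inside the window the exponential is at most 1; at its end the choice of [T] gives the factor
   [1 / 2]. *)
split=> [d d0 dT|].
  apply: le_trans (close d d0 dT) _; rewrite lerD2r ler_piMr ?mulr_ge0 ?(ltW c0)//.
  by rewrite -expR0 ler_expR oppr_le0 mulr_ge0// ltW.
apply: le_trans (close T (ltW T0) (lexx _)) _; rewrite lerD2r.
by rewrite mulrAC [leRHS]mulrC ler_wpM2r// -[_^-1]mul1r.
Unshelve. all: by end_near. Qed.
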